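(* Let $m\ge2$, let $p_1,\dots,p_m>0$ with $\sum_i p_i=1$ be linearly independent over $\mathbb{Q}$, and let $\beta\in\mathbb{R}$. For the $\beta$-linear divisor method, with $N$ uniformly distributed on $\{1,\dots,N_0\}$, as $N_0\to\infty$, for every $i$, $$\mathbb{E}\,\Delta_i\to \Bigl(\beta-\tfrac12\Bigr)(mp_i-1).$$
   Context: There are $m$ parties; party $i$ has proportion $p_i>0$ of the votes. $N$ (the house size) seats are distributed, party $i$ gets $s_i=s_i(N)$ seats with $\sum_i s_i=N$, and the seat excess is $\Delta_i=s_i-Np_i$. For real $\alpha,x$, the $\alpha$-rounding $[x]_\alpha$ is an integer $n$ with $x-\alpha\le n\le x-\alpha+1$ (if $x-\alpha\in\mathbb{Z}$, both $x-\alpha$ and $x-\alpha+1$ are accepted values). The $\beta$-linear divisor method: $s_i=\max\{[p_i/D']_\beta,0\}$ where the real number $D'>0$ (and the choices of rounding in case of ties) are such that $\sum_i s_i=N$. The maximum with $0$ only matters if $\beta>1$ and $N$ is small; if $\beta\le 0$ the method is defined only for $N\ge m(\lfloor|\beta|\rfloor+1)$. Ties are resolved at random. Finitely many $N$ for which the method is undefined are irrelevant for the limit and may be ignored. *)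

(* Defs.v *)
From HB Require Import structures.
From mathcomp Require Import all_boot all_order all_algebra.
From mathcomp Require Import all_classical all_reals all_analysis.
Set Implicit Arguments.
Unset Strict Implicit.
Unset Printing Implicit Defensive.
Import Order.TTheory GRing.Theory Num.Theory.
Import numFieldNormedType.Exports.
Local Open Scope classical_set_scope.
Local Open Scope ring_scope.

Definition rat_linear_independent (R : realType) (m : nat) (p : 'I_m -> R) : Prop :=
  forall q : 'I_m -> rat, \sum_(i < m) ratr (q i) * p i = 0 -> forall i, q i = 0.

(* A relation rather than a function: both neighbouring integers qualify when
   [x - alpha] is an integer. *)
Definition is_rounding (R : realType) (alpha x : R) (n : int) : Prop :=
  x - alpha <= n%:~R <= x - alpha + 1.

(* Seat numbers are nonnegative and sum to the house size [N], so each of them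
   lies in [{0, ..., N}]; this makes the type of outcomes finite. *)
Definition seats (m N : nat) := {ffun 'I_m -> 'I_N.+1}.

Definition linear_divisor_outcome (R : realType) (m : nat) (beta : R)
    (p : 'I_m -> R) (N : nat) (s : seats m N) : Prop :=
  (\sum_(i < m) (s i : nat))%N = N /\
  exists2 D : R, 0 < D &
    exists r : 'I_m -> int, forall i,
      is_rounding beta (p i / D) (r i) /\ (s i : nat)%:Z = Num.max (r i) 0.

Definition linear_divisor_defined (R : realType) (m : nat) (beta : R)
    (N : nat) : Prop :=
  beta <= 0 -> m%:Z * (Num.floor `|beta| + 1) <= N%:Z.

(* [mu] is the law of the seat vector for the house size [N]; the only
   randomness is in the resolution of ties, and how a tie is randomised is left
   arbitrary. For the finitely many [N] for which the method is undefined, [mu]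
   is any law on [seats m N]. *)
Definition linear_divisor_law (R : realType) (m : nat) (beta : R)
    (p : 'I_m -> R) (N : nat) (mu : seats m N -> R) : Prop :=
  [/\ forall s, 0 <= mu s,
      \sum_(s : seats m N) mu s = 1
    & linear_divisor_defined m beta N ->
      forall s, mu s != 0 -> linear_divisor_outcome beta p s].

Definition seat_excess (R : realType) (m : nat) (p : 'I_m -> R) (N : nat)
    (s : seats m N) (i : 'I_m) : R :=
  (s i : nat)%:R - N%:R * p i.

(* Expectation over [N] uniform on [{1, ..., N0}] and, given [N], over a seat
   vector with law [law N]. *)
Definition expected_excess (R : realType) (m : nat) (p : 'I_m -> R)
    (law : forall N : nat, seats m N -> R) (N0 : nat) (i : 'I_m) : R :=
  N0%:R^-1 * \sum_(1 <= N < N0.+1)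
    \sum_(s : seats m N) law N s * seat_excess p s i.

(* Main.v *)
Require Import Defs.
From HB Require Import structures.
From mathcomp Require Import all_boot all_order all_algebra.
From mathcomp Require Import all_classical all_reals all_analysis.
From mathcomp Require Import ring lra zify.
Set Implicit Arguments.
Unset Strict Implicit.
Unset Printing Implicit Defensive.
Import Order.TTheory GRing.Theory Num.Theory.
Import numFieldNormedType.Exports.
Local Open Scope classical_set_scope.
Local Open Scope ring_scope.

(* Put t = 1/D and let t grow. Two parties tie at most once, so for large N the
   seat vector is unique and is the one just after some time t at which a party
   j wins a seat: p_j t - beta = s_j - 1 and s_i = floor (p_i t - beta) + 1.
   With f_i = frac (p_i t - beta) the excess is
     (1 - beta) (1 - m p_i) - f_i + p_i \sum_k f_k.
   The times at which j wins are (l + beta) / p_j, l integer; along them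
   f_j = 0, while f_k has mean 1/2 for k <> j because p_k / p_j is irrational.
   Party j wins with frequency p_j, so f_k has mean (1 - p_k) / 2 overall. *)

(** * Fractional parts along an irrational rotation *)

Section FractionalPart.
Variable R : realType.
Implicit Types (x c t alpha : R) (z b : int).

Definition frac x : R := x - (Num.floor x)%:~R.

Lemma frac_itv x : 0 <= frac x < 1.
Proof.
by rewrite /frac; have := floor_itv x; rewrite intrD => /andP[]; lra.
Qed.

Lemma fracDz x z : frac (x + z%:~R) = frac x.
Proof.
rewrite /frac floorDrz ?intr_int// intrKfloor intrD; lra.
Qed.

Lemma frac_int z : frac z%:~R = 0.
Proof. by rewrite /frac intrKfloor subrr. Qed.

Lemma frac_add x t : 0 <= t < 1 ->
  frac (x + t) = frac x + t \/ frac (x + t) = frac x + t - 1.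
Proof.
move=> t01; have := frac_itv x; rewrite /frac => fx.
have [lt1|ge1] := ltP (frac x + t) 1.
  left; rewrite (@floor_def _ _ (Num.floor x)); first lra.
  by rewrite intrD; move: lt1; rewrite /frac; lra.
right; rewrite (@floor_def _ _ (Num.floor x + 1)) ?intrD; first lra.
by move: ge1; rewrite /frac; lra.
Qed.

(* Shifting by [alpha] changes the sum by a difference of two values of [g]. *)
Lemma sum_shift_le (g : R -> R) alpha c z n : (forall x, 0 <= g x <= 1) ->
  `|\sum_(l < n) g (l%:R * alpha + c + z%:~R * alpha)
    - \sum_(l < n) g (l%:R * alpha + c)| <= `|z|%:~R.
Proof.
move=> g01; pose T x := \sum_(l < n) g (l%:R * alpha + x).
have step x : `|T (x + alpha) - T x| <= 1.
  have -> : T (x + alpha) - T x = g (n%:R * alpha + x) - g x.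
    rewrite /T -sumrB (eq_bigr (fun l : 'I_n =>
      g (l.+1%:R * alpha + x) - g (l%:R * alpha + x))); last first.
      by move=> l _; congr (g _ - _); rewrite -natr1; ring.
    rewrite -(big_mkord xpredT (fun l =>
      g (l.+1%:R * alpha + x) - g (l%:R * alpha + x))).
    by rewrite telescope_sumr// mul0r add0r.
  by have := g01 (n%:R * alpha + x); have := g01 x; rewrite ler_norml; lra.
have natshift k x : `|T (x + k%:R * alpha) - T x| <= k%:R.
  elim: k => [|k IH]; first by rewrite mul0r addr0 subrr normr0.
  have := step (x + k%:R * alpha).
  have -> : x + k%:R * alpha + alpha = x + k.+1%:R * alpha.
    by rewrite -natr1; ring.
  by move: IH; rewrite -natr1 !ler_norml; lra.
have TE w : \sum_(l < n) g (l%:R * alpha + c + w) = T (c + w).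
  by apply: eq_bigr => l _; rewrite addrA.
rewrite TE -/(T c); case: z => k; first exact: natshift.
rewrite NegzE distrC normrN.
have := natshift k.+1 (c + (- k.+1%:Z)%:~R * alpha).
by rewrite intrN mulNr subrK.
Qed.

(* Euclidean step: if [t] is such a combination and [1 = q t + r] with
   [0 <= r < t], then [r] and [t - r] are too, and one is at most [t / 2]. *)
Lemma small_integer_combination alpha :
  (forall z b, z%:~R * alpha = b%:~R -> z = 0) ->
  forall e, 0 < e -> exists z b, 0 < z%:~R * alpha - b%:~R < e.
Proof.
move=> irr.
have nz z b : z != 0 -> z%:~R * alpha - b%:~R != 0.
  by apply: contra; rewrite subr_eq0 => /eqP/irr ->.
have halve k : exists z b, 0 < z%:~R * alpha - b%:~R < (2^-1 : R) ^+ k.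
  elim: k => [|k [z [b]]].
    exists 1, (Num.floor alpha); rewrite expr0 mul1r.
    have /andP[ge0 ->] := frac_itv alpha; rewrite andbT lt_neqAle ge0 andbT.
    by have := nz 1 (Num.floor alpha) isT; rewrite mul1r eq_sym.
  set t := _ - _ => /andP[t0 tk].
  have znz : z != 0.
    apply/eqP => z0; move: t0 tk; rewrite /t z0 mul0r sub0r -intrN => b0 bk.
    have : (-b)%:~R < (1 : R).
      by apply: (lt_le_trans bk); rewrite exprn_ile1 ?invr_ge0 ?invf_le1 ?ler1n.
    rewrite -[1]/(1%:~R) ltr_int; move: b0; rewrite -[0]/(0%:~R) ltr_int; lia.
  have := floor_itv t^-1; set q := Num.floor _; rewrite intrD => /andP[q1 q2].
  have qt : q%:~R * t <= 1 by rewrite -ler_pdivlMr// mul1r.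
  have qt2 : 1 < (q%:~R + 1) * t by rewrite -ltr_pdivrMr// mul1r.
  have tk2 : t / 2 < 2^-1 ^+ k.+1 by rewrite exprS; lra.
  have [small|big] := leP (1 - q%:~R * t) (t / 2).
  - exists (- (q * z)), (- (q * b) - 1).
    have E : (- (q * z))%:~R * alpha - (- (q * b) - 1)%:~R = 1 - q%:~R * t.
      by rewrite intrB !intrN !intrM /t; ring.
    (* [nz] applies only to a nonzero multiplier [q * z]; if [q = 0] the remainder is [1], positive
       outright. *)
    have [q0|qn0] := eqVneq q 0.
      by move: small; rewrite q0 mul0r subr0; move: qt2; rewrite q0; lra.
    have := nz (- (q * z)) (- (q * b) - 1).
    rewrite E oppr_eq0 mulf_neq0// => /(_ isT).
    by move=> ne; rewrite (le_lt_trans small)// andbT lt_neqAle eq_sym ne; lra.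
  - exists ((q + 1) * z), ((q + 1) * b + 1).
    have -> : ((q + 1) * z)%:~R * alpha - ((q + 1) * b + 1)%:~R
        = (q%:~R + 1) * t - 1.
      by rewrite !(intrD, intrM) /t; ring.
    by lra.
move=> e e0.
have [k _ /(_ k)] : \forall k \near \oo, 2^-1 ^+ k < e.
  have half_lt1 : `|2^-1 : R| < 1.
    by rewrite ger0_norm ?invr_ge0// invf_lt1 ?ltr1n.
  have /cvgrPdist_lt/(_ e e0) := cvg_expr half_lt1.
  apply: filterS => k; rewrite sub0r normrN; exact: le_lt_trans (ler_norm _).
move=> /(_ (leqnn _)) ke; have [z [b /andP[b0 bk]]] := halve k.
by exists z, b; rewrite b0 (lt_trans bk).
Qed.

(* With [t] small and congruent to a multiple of [alpha] mod 1, and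
   [h = f - f ^+ 2], the difference [h x - h (x + t)] is about
   [2 t (f x - 1/2)] off the jumps of [f], while its sum over the orbit stays
   bounded by [sum_shift_le]; the jumps are counted by [f x + t - f (x + t)]. *)
Lemma mean_frac alpha c :
  (forall z b, z%:~R * alpha = b%:~R -> z = 0) ->
  n%:R^-1 * (\sum_(l < n) frac (l%:R * alpha + c)) @[n --> \oo] --> (2^-1 : R).
Proof.
move=> irr; apply/cvgrPdist_le => e e0.
have [] := @small_integer_combination alpha irr (Num.min e 1).
  by rewrite lt_min e0 ltr01.
move=> z [b]; rewrite lt_min => /and3P[].
set t := _ - _ => t0 te t1.
pose h x : R := frac x - frac x ^+ 2.
have h01 x : 0 <= h x <= 1.
  by have := frac_itv x; rewrite /h => /andP[? ?]; nra.
have f01 x : 0 <= frac x <= 1 by have := frac_itv x; lra.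
have shift x : x + z%:~R * alpha = x + t + b%:~R by rewrite /t; ring.
have fshift n := sum_shift_le alpha c z n f01.
have hshift n := sum_shift_le alpha c z n h01.
have pointwise x :
  h x - h (x + t) <= 2 * t * (frac x - 2^-1) + t ^+ 2
    <= h x - h (x + t) + 2 * t * (frac x + t - frac (x + t)).
  have := frac_itv x; have := frac_itv (x + t) => /andP[? ?] /andP[? ?].
  have [|E|E] := @frac_add x t; first by lra.
  - by rewrite /h E; apply/andP; split; nra.
  - move: (frac_itv (x + t)); rewrite /h E => /andP[? ?].
    by apply/andP; split; nra.
pose Z : R := `|z|%:~R.
(* The summed [pointwise] bounds divided by [2 * t]: [t ^+ 2] from each term, [Z] from the shift of
   [h], and [2 * t * Z] from the count of jumps. *)
have main n : `|\sum_(l < n) frac (l%:R * alpha + c) - n%:R / 2|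
    <= n%:R * t / 2 + Z * (1 + 2 * t) / (2 * t).
  pose T := \sum_(l < n) frac (l%:R * alpha + c).
  pose T' := \sum_(l < n) frac (l%:R * alpha + c + t).
  pose H := \sum_(l < n) h (l%:R * alpha + c).
  pose H' := \sum_(l < n) h (l%:R * alpha + c + t).
  have fs : `|T' - T| <= Z.
    have := fshift n; congr (`|_ - _| <= _).
    by apply: eq_bigr => l _; rewrite shift fracDz.
  have hs : `|H' - H| <= Z.
    have := hshift n; congr (`|_ - _| <= _).
    by apply: eq_bigr => l _; rewrite shift /h fracDz.
  have sums a1 a2 a3 a4 a5 : \sum_(l < n) (a1 * h (l%:R * alpha + c)
      + a2 * h (l%:R * alpha + c + t) + a3 * frac (l%:R * alpha + c)
      + a4 * frac (l%:R * alpha + c + t) + a5) =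
      a1 * H + a2 * H' + a3 * T + a4 * T' + a5 * n%:R.
    by rewrite !big_split/= -!mulr_sumr sumr_const card_ord -[a5 *+ n]mulr_natr.
  have lo : H - H' <= 2 * t * T - t * n%:R + t ^+ 2 * n%:R.
    have := sums (- 1) 1 (2 * t) 0 (- t + t ^+ 2).
    have : 0 <= \sum_(l < n) (- 1 * h (l%:R * alpha + c)
      + 1 * h (l%:R * alpha + c + t) + (2 * t) * frac (l%:R * alpha + c)
      + 0 * frac (l%:R * alpha + c + t) + (- t + t ^+ 2)).
      apply: sumr_ge0 => l _.
      by have /andP[] := pointwise (l%:R * alpha + c); lra.
    by move=> + E; rewrite E; lra.
  have hi : 2 * t * T - t * n%:R <= H - H' + 2 * t * (T - T') + t ^+ 2 * n%:R.
    have := sums 1 (- 1) 0 (- (2 * t)) (t + t ^+ 2).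
    have : 0 <= \sum_(l < n) (1 * h (l%:R * alpha + c)
      + (- 1) * h (l%:R * alpha + c + t) + 0 * frac (l%:R * alpha + c)
      + (- (2 * t)) * frac (l%:R * alpha + c + t) + (t + t ^+ 2)).
      apply: sumr_ge0 => l _.
      by have /andP[] := pointwise (l%:R * alpha + c); lra.
    by move=> + E; rewrite E; lra.
  have tZ : t * (T - T') <= t * Z.
    by rewrite ler_pM2l//; move: fs; rewrite ler_norml; lra.
  have t2 : 0 < 2 * t by lra.
  have KE : 2 * t * (n%:R * t / 2 + Z * (1 + 2 * t) / (2 * t))
     = t ^+ 2 * n%:R + Z * (1 + 2 * t) by field; lra.
  move: hs; rewrite !ler_norml => /andP[hs1 hs2].
  have Z0 : 0 <= Z * t by rewrite mulr_ge0 ?(ltW t0)// ler0z.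
  by apply/andP; split; rewrite -(ler_pM2l t2) -/T ?mulrN KE; lra.
set K := Z * _ / _ in main.
have K0 : 0 <= K.
  by rewrite /K divr_ge0 ?mulr_ge0 ?ler0z//; lra.
near=> n.
have n0 : (0 : R) < n%:R by rewrite ltr0n; near: n; exists 1%N.
have Kn : K <= e / 2 * n%:R.
  rewrite -ler_pdivrMl ?divr_gt0//; near: n; exact: nbhs_infty_ger.
have te' : n%:R * t <= n%:R * e by rewrite ler_pM2l// ltW.
rewrite -(ler_pM2l n0) -[X in X * `|_|]gtr0_norm// -normrM.
rewrite mulrBr mulrA mulfV ?gt_eqF// mul1r distrC.
by apply: (le_trans (main n)); lra.
Unshelve. all: by end_near. Qed.
End FractionalPart.

(** * Limits of averages *)

Section Averages.
Variable R : realType.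

Lemma invn_cvg0 : (n%:R^-1 : R) @[n --> \oo] --> (0 : R).
Proof.
apply: (gtr0_cvgV0 _).2; last exact: cvgr_idn.
by exists 1%N => // n /=; rewrite ltr0n.
Qed.

Lemma average_of_linear (u : nat -> R) (l K : R) :
  (\forall n \near \oo, `|u n - n%:R * l| <= K) ->
  n%:R^-1 * u n @[n --> \oo] --> l.
Proof.
move=> uK; apply/cvgrPdist_le => e e0; near=> n.
have n0 : (0 : R) < n%:R by rewrite ltr0n; near: n; exists 1%N.
have Kn : K <= e * n%:R.
  by rewrite -ler_pdivrMl//; near: n; exact: nbhs_infty_ger.
rewrite -(ler_pM2l n0) -[X in X * `|_|]gtr0_norm// -normrM.
rewrite mulrBr mulrA mulfV ?gt_eqF// mul1r distrC [_ * e]mulrC.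
by apply: le_trans Kn; near: n.
Unshelve. all: by end_near. Qed.

(** The terms before the identity sets in contribute a constant [c], which the factor [n%:R^-1]
    removes. *)
Lemma average_telescope (E H : nat -> R) (l : R) :
  (\forall n \near \oo, E n.+1 = H n.+1 - H n) ->
  n%:R^-1 * H n @[n --> \oo] --> l ->
  n%:R^-1 * (\sum_(1 <= k < n.+1) E k) @[n --> \oo] --> l.
Proof.
move=> [n1 _ EH] Hl; pose c := \sum_(1 <= k < n1.+1) E k - H n1.
have sumE n : (n1 <= n)%N -> \sum_(1 <= k < n.+1) E k = H n + c.
  move=> le_n; rewrite (@big_cat_nat _ _ _ n1.+1)//= /c.
  rewrite [X in _ + X](_ : _ = H n - H n1); first by lra.
  rewrite -(telescope_sumr _ le_n) big_add1/= big_nat [RHS]big_nat.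
  by apply: eq_bigr => k /andP[+ _]; exact: EH.
have : (n%:R^-1 * H n + n%:R^-1 * c) @[n --> \oo] --> l + 0 * c.
  by apply: cvgD => //; apply: cvgM; [exact: invn_cvg0|exact: cvg_cst].
rewrite mul0r addr0 => lim; apply: cvg_trans lim; apply: near_eq_cvg.
by exists n1 => // n /= le_n; rewrite sumE// [RHS]mulrDr.
Qed.

Lemma cvg_sum_ord (m : nat) (u : 'I_m -> nat -> R) (l : 'I_m -> R) :
  (forall i, u i n @[n --> \oo] --> l i) ->
  (\sum_i u i n) @[n --> \oo] --> \sum_i l i.
Proof.
move=> ul; elim: (index_enum 'I_m) => [|i r IH].
  by rewrite big_nil; under eq_fun do rewrite big_nil; exact: cvg_cst.
by rewrite big_cons; under eq_fun do rewrite big_cons; exact: cvgD.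
Qed.

End Averages.

Lemma sum_nat_eq_pointwise (m : nat) (a b : 'I_m -> nat) :
  (forall i, a i <= b i)%N -> (\sum_i a i = \sum_i b i)%N ->
  forall i, a i = b i.
Proof.
move=> ab sab i; apply/eqP; rewrite eqn_leq ab /= leqNgt; apply/negP => lt_ab.
suff : (\sum_i a i < \sum_i b i)%N by rewrite sab ltnn.
rewrite (bigD1 i)//= [X in (_ < X)%N](bigD1 i)//=.
by rewrite -addSn leq_add// leq_sum.
Qed.

(** * Jump times of the divisor method *)

Section LinearDivisor.
Variables (R : realType) (m : nat) (p : 'I_m -> R) (beta : R).
Hypotheses (hp : forall i, 0 < p i) (hsum : \sum_(i < m) p i = 1).
Hypothesis hind : rat_linear_independent p.

Lemma incommensurable j k (a b : int) : j != k ->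
  a%:~R * p k = b%:~R * p j -> a = 0 /\ b = 0.
Proof.
move=> jk ab.
pose q i : rat := if i == k then a%:~R else if i == j then - b%:~R else 0.
have : \sum_(i < m) ratr (q i) * p i = 0.
  rewrite (bigD1 k)//= (bigD1 j)//= big1 => [|i /andP[ik ij]].
    rewrite /q eqxx (negbTE jk) eqxx rmorphN /= !ratr_int; lra.
  by rewrite /q (negbTE ik) (negbTE ij) rmorph0 mul0r.
move=> /hind q0; have := q0 k; have := q0 j.
rewrite /q !eqxx (negbTE jk) => /eqP; rewrite oppr_eq0 intr_eq0 => /eqP -> /eqP.
by rewrite intr_eq0 => /eqP.
Qed.

(* Two ties between [j] and [k] at distinct times would give a rational
   relation between [p j] and [p k]. *)
Lemma finitely_many_ties : \forall t \near +oo, forall j k (a b : int),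
  j != k -> p j * t - beta = a%:~R -> p k * t - beta = b%:~R -> False.
Proof.
apply: filter_forall => j; apply: filter_forall => k.
have [jk|_] := boolP (j != k); last by near=> t.
have [[t0 [a0 [b0 [ea0 eb0]]]]|none] := pselect (exists t0 (a0 b0 : int),
  p j * t0 - beta = a0%:~R /\ p k * t0 - beta = b0%:~R); last first.
  by near=> t => a b _ ea eb; apply: none; exists t, a, b.
near=> t => a b _ ea eb.
have lt_t : t0 < t by near: t; apply: nbhs_pinfty_gt; rewrite num_real.
have : (a - a0)%:~R * p k = (b - b0)%:~R * p j.
  by rewrite !intrB -ea -ea0 -eb -eb0; ring.
move=> /(incommensurable jk)[/eqP]; rewrite subr_eq0 => /eqP aa0 _.
have : p j * (t - t0) = 0 by move: ea; rewrite aa0 -ea0; lra.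
by move/eqP; rewrite mulf_eq0 gt_eqF//= subr_eq0 gt_eqF.
Unshelve. all: by end_near. Qed.

(* The seat vector just after the time [t] at which [j] wins a seat, when the
   divisor is [t^-1]. *)
Definition at_jump (t : R) (j : 'I_m) (s : 'I_m -> nat) :=
  (forall i, (s i)%:Z = Num.floor (p i * t - beta) + 1) /\
  p j * t - beta = (s j)%:R - 1.

(** Lowering the time [D^-1] to the latest moment at which some party won its last seat leaves every
    seat number unchanged. *)
Lemma outcome_at_jump : \forall N \near \oo, forall s : seats m N,
  linear_divisor_outcome beta p s -> exists t j, at_jump t j (fun i => s i).
Proof.
have m0 : (0 < m)%N.
  by case: m p hsum => // q /eqP; rewrite big_ord0 eq_sym oner_eq0.
have pos : \forall t \near +oo, forall i, beta < p i * t.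
  apply: filter_forall => i; near=> t.
  rewrite mulrC -ltr_pdivrMr//; near: t.
  by apply: nbhs_pinfty_gt; rewrite num_real.
have [T [_ HT]] := filterI finitely_many_ties pos.
(* Each seat number differs from [p i] times the time by at most [|beta| + 1] upwards, so this bound
   puts both [D^-1] and the jump time [t] beyond [T]. *)
have : \forall N \near \oo, T + m%:R * (`|beta| + 1) + 1 <= (N%:R : R).
  exact: nbhs_infty_ger.
apply: filterS => N TN s [sN [D D0 [r hr]]].
have beta_abs := ler_norm beta.
have beta_absN : - beta <= `|beta| by rewrite -normrN ler_norm.
have sumc (c : R) : \sum_(i < m) c = m%:R * c.
  by rewrite sumr_const card_ord mulr_natl.
have NE : N%:R = \sum_i (s i)%:R :> R by rewrite -natr_sum sN.
have ltT : T < D^-1.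
  have : N%:R <= \sum_i (p i * D^-1 + (`|beta| + 1)).
    rewrite NE; apply: ler_sum => i _.
    have [/andP[_ r2] /(congr1 (fun z : int => z%:~R : R))] := hr i.
    rewrite -pmulrn => ->; have pD : 0 <= p i / D by rewrite divr_ge0 ?ltW.
    by rewrite maxEle; case: ifP => _; lra.
  by rewrite big_split/= -mulr_suml hsum mul1r sumc; lra.
(* Beyond [T] every [p i / D] exceeds [beta], so [r i] is positive and the maximum with [0] is
   inactive. *)
have sr i : p i / D - beta <= (s i)%:R <= p i / D - beta + 1.
  have [_ /(_ i) pb] := HT _ ltT.
  have [/andP[r1 r2] E] := hr i.
  have r0 : 0 < r i by rewrite -(ltr_int R); lra.
  have -> : (s i)%:R = (r i)%:~R :> R.
    by rewrite pmulrn E max_l ?ltW.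
  by rewrite r1 r2.
(* The time at which party [i] won its last seat; the largest of these is the jump time sought. *)
pose u i := ((s i)%:R - 1 + beta) / p i.
have [j _ jmax] := arg_maxP u (erefl : xpredT (Ordinal m0)).
set t := u j in jmax.
have uP i : (s i)%:R - 1 <= p i * t - beta.
  have : u i <= t by exact: jmax.
  by rewrite {1}/u ler_pdivrMr// [t * _]mulrC; lra.
have jt : p j * t - beta = (s j)%:R - 1.
  by rewrite /t /u mulrCA mulfV ?gt_eqF//; lra.
have tD : t <= D^-1.
  by rewrite /t /u ler_pdivrMr// [_ * p j]mulrC; have := sr j; lra.
have Tt : T < t.
  have : \sum_i (s i)%:R <= \sum_i (p i * t + (1 - beta)).
    by apply: ler_sum => i _; have := uP i; lra.
  rewrite -NE big_split/= -mulr_suml hsum mul1r sumc.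
  have : m%:R * (1 - beta) <= m%:R * (`|beta| + 1) by rewrite ler_wpM2l//; lra.
  lra.
exists t, j; split=> // i.
have [noties _] := HT _ Tt.
have Di : p i * t <= p i / D by rewrite ler_pM2l.
(* Equality would make [i] and [j] tie at time [t], which is excluded beyond [T]. *)
suff lt_i : p i * t - beta < (s i)%:R.
  by rewrite (@floor_def _ _ ((s i)%:Z - 1)) ?subrK// intrB -pmulrn uP.
have [->|ij] := eqVneq i j; first by rewrite jt; lra.
rewrite lt_neqAle; apply/andP; split; last by have := sr i; lra.
apply/eqP => tie; apply: (noties i j (s i)%:Z ((s j)%:Z - 1) ij).
  by rewrite tie.
by rewrite jt intrB.
Unshelve. all: by end_near. Qed.

Lemma at_jump_mono t t' j j' s s' : at_jump t j s -> at_jump t' j' s' ->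
  t <= t' -> forall i, (s i <= s' i)%N.
Proof.
move=> [hs _] [hs' _] tt' i; rewrite -lez_nat hs hs' lerD2r le_floor//.
by rewrite lerD2r ler_pM2l.
Qed.

(** Seat vectors at jumps increase with time in every coordinate, so the total determines the
    vector. *)
Lemma at_jump_inj t t' j j' s s' : at_jump t j s -> at_jump t' j' s' ->
  (\sum_i s i = \sum_i s' i)%N -> forall i, s i = s' i.
Proof.
move=> hs hs' ss' i; have [tt'|/ltW tt'] := leP t t'.
- exact: (sum_nat_eq_pointwise (at_jump_mono hs hs' tt')).
- exact/esym/(sum_nat_eq_pointwise (at_jump_mono hs' hs tt')).
Qed.

(** The jump [t] comes strictly later, and [p j * t - beta] is an integer, so [j] has gained at
    least one seat. This lower bound already has the right total. *)
Lemma at_jump_succ t t' j j' s s' : at_jump t j s -> at_jump t' j' s' ->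
  (\sum_i s i = (\sum_i s' i).+1)%N -> forall i, s i = (s' i + (i == j))%N.
Proof.
move=> hs hs' ss' i.
have tt' : t' < t.
  rewrite ltNge; apply/negP => /(at_jump_mono hs hs') le_ss'.
  suff : (\sum_i s i <= \sum_i s' i)%N by rewrite ss' ltnn.
  by apply: leq_sum => k _; exact: le_ss'.
apply/esym.
apply: (@sum_nat_eq_pointwise _ (fun i => s' i + (i == j))%N) => [k|].
- have [->|_] := eqVneq k j; last first.
    by rewrite addn0; exact: (at_jump_mono hs' hs (ltW tt')).
  have [/(_ j) sj _] := hs'; have [_ tj] := hs.
  have := floor_le (p j * t' - beta); rewrite -[Num.floor _](addrK 1) -sj intrB.
  have : p j * t' < p j * t by rewrite ltr_pM2l.
  move=> lt_t le_t; rewrite addn1 -(ltr_nat R) pmulrn; lra.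
- rewrite big_split/= ss' -(big_mkcond (pred1 j) (fun=> 1%N)) /=.
  by rewrite big_pred1_eq addn1.
Qed.

(** Each [s k] is [p k * t + (1 - beta)] minus a fractional part; since the [p k] sum to [1], the
    time [t] cancels. *)
Lemma excess_at_jump t j s i : at_jump t j s ->
  (s i)%:R - (\sum_k s k)%:R * p i =
  (1 - beta) * (1 - m%:R * p i) - frac (p i * t - beta)
  + p i * \sum_k frac (p k * t - beta).
Proof.
move=> [hs _].
have sE k : (s k)%:R = p k * t + (1 - beta) - frac (p k * t - beta).
  rewrite -[LHS]/((s k)%:Z%:~R) hs intrD /frac; lra.
rewrite natr_sum (eq_bigr _ (fun k _ => sE k)) sE sumrB big_split/=.
rewrite -mulr_suml hsum mul1r sumr_const card_ord -[_ *+ m]mulr_natl; ring.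
Qed.

(* [l + 1] seats are reached by party [j] at time [(l + beta) / p j]. *)
Definition jump_sum (j k : 'I_m) (n : nat) : R :=
  \sum_(l < n) frac (p k * ((l%:R + beta) / p j) - beta).

(** For [j = k] the arguments are the integers [l]; otherwise they form an orbit of the rotation by
    [p k / p j], irrational by [incommensurable]. *)
Lemma jump_sum_mean j k :
  n%:R^-1 * jump_sum j k n @[n --> \oo] --> (2^-1 * (j != k)%:R : R).
Proof.
have [->|jk] := eqVneq j k.
  rewrite mulr0; apply: cvg_near_cst; near=> n.
  rewrite /jump_sum big1 ?mulr0// => l _.
  by rewrite mulrCA mulfV ?gt_eqF// mulr1 addrK pmulrn frac_int.
rewrite mulr1.
have irr (z b : int) : z%:~R * (p k / p j) = b%:~R -> z = 0.
  move=> zb; apply: (proj1 (incommensurable (b := b) jk _)).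
  by rewrite -zb mulrA -mulrA mulVf ?gt_eqF// mulr1.
have E n : jump_sum j k n =
    \sum_(l < n) frac (l%:R * (p k / p j) + (beta * p k / p j - beta)).
  by apply: eq_bigr => l _; congr frac; field; rewrite gt_eqF.
by under eq_fun do rewrite E; exact: mean_frac.
Unshelve. all: by end_near. Qed.

(** Only the sum for the winner [j] gains a term, with index [s' j], and the time
    [((s' j)%:R + beta) / p j] of that term is [t]. This turns fractional parts at jumps into
    differences that telescope. *)
Lemma jump_sum_step t t' j j' s s' k : at_jump t j s -> at_jump t' j' s' ->
  (\sum_i s i = (\sum_i s' i).+1)%N ->
  frac (p k * t - beta) =
  \sum_i jump_sum i k (s i) - \sum_i jump_sum i k (s' i).
Proof.
move=> hs hs' ss'; have sE := at_jump_succ hs hs' ss'.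
rewrite -sumrB (bigD1 j)//= big1 => [|i ij]; last first.
  by rewrite sE (negbTE ij) addn0 subrr.
rewrite sE eqxx addn1 /jump_sum big_ord_recr/= addr0 addrAC subrr add0r.
congr (frac (_ * _ - _)); have [_] := hs; rewrite sE eqxx addn1 -natr1.
move=> E; have -> : (s' j)%:R + beta = p j * t by lra.
by rewrite mulrAC mulfV ?gt_eqF// mul1r.
Qed.

End LinearDivisor.

(** * Passage to the expected excess *)

(** For large [N] all outcomes in the support are jump vectors with total [N], hence equal by
    [at_jump_inj]; the randomisation of ties disappears. *)
Lemma law_eventually_deterministic (R : realType) (m : nat) (p : 'I_m -> R)
    (beta : R) (law : forall N : nat, seats m N -> R)
    (hp : forall i, 0 < p i) (hsum : \sum_(i < m) p i = 1)
    (hind : rat_linear_independent p)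
    (hlaw : forall N : nat, linear_divisor_law beta p (law N)) :
  exists sigma : nat -> 'I_m -> nat, \forall N \near \oo,
    [/\ exists t j, at_jump p beta t j (sigma N),
        (\sum_i sigma N i = N)%N
      & forall i, \sum_(s : seats m N) law N s * seat_excess p s i
                  = (sigma N i)%:R - N%:R * p i].
Proof.
have defined : \forall N \near \oo, linear_divisor_defined m beta N.
  exists `|(m%:Z * (Num.floor `|beta| + 1))%R|%N => // N /= leN _.
  by apply: le_trans (lez_abs _) _; rewrite lez_nat.
have [N1 _ HN1] := filterI (outcome_at_jump beta hp hsum hind) defined.
suff /choice[sigma hsigma] N : exists sg : 'I_m -> nat, (N1 <= N)%N ->
    [/\ exists t j, at_jump p beta t j sg, (\sum_i sg i = N)%N
      & forall i, \sum_(s : seats m N) law N s * seat_excess p s i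
                  = (sg i)%:R - N%:R * p i].
  by exists sigma, N1.
have [/HN1[jump def]|//] := boolP (N1 <= N)%N; last by exists (fun=> 0%N).
have [law_ge0 law1 law_out] := hlaw N.
have [s0 s0_supp] : exists s, law N s != 0.
  apply: contrapT => /forallNP no; move: law1; rewrite big1 => [/eqP|s _].
    by rewrite eq_sym oner_eq0.
  by apply/eqP/negPn/negP; exact: no.
have out0 := law_out def _ s0_supp.
have [t [j jump0]] := jump _ out0.
have unique s : law N s != 0 -> forall i, s i = s0 i :> nat.
  move=> /(law_out def) out; have [t' [j' jump']] := jump _ out.
  by apply: (at_jump_inj hp jump' jump0); rewrite out.1 out0.1.
exists (fun i => s0 i) => _; split=> [||i]; [by exists t, j|exact: out0.1|].
rewrite -[RHS]mul1r -{1}law1 mulr_suml; apply: eq_bigr => s _.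
have [->|/unique E] := eqVneq (law N s) 0; first by rewrite !mul0r.
by rewrite /seat_excess E.
Qed.

Theorem theorem3p4 (R : realType) (m : nat) (p : 'I_m -> R) (beta : R)
    (law : forall N : nat, seats m N -> R)
    (hm : (2 <= m)%N)
    (hp : forall i, 0 < p i)
    (hsum : \sum_(i < m) p i = 1)
    (hind : rat_linear_independent p)
    (hlaw : forall N : nat, linear_divisor_law beta p (law N)) :
  forall i : 'I_m,
    expected_excess p law N0 i @[N0 --> \oo] -->
      (beta - 2^-1) * (m%:R * p i - 1).
Proof.
move=> i.
have [sigma hsigma] := law_eventually_deterministic hp hsum hind hlaw.
pose C k := (1 - beta) * (1 - m%:R * p k).
(* In [excess_at_jump] one fractional part is at most [1] and the sum of all is at most [m]. *)
have sigma_near k : \forall n \near \oo,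
    `|(sigma n k)%:R - n%:R * p k| <= `|C k| + 1 + p k * m%:R.
  apply: filterS hsigma => n [[t [j jump]] sn _].
  have := excess_at_jump hsum k jump; rewrite sn -/(C k) => ->.
  have f01 l := frac_itv (p l * t - beta).
  have sum0 : 0 <= \sum_l frac (p l * t - beta).
    by apply: sumr_ge0 => l _; have := f01 l; lra.
  have summ : \sum_l frac (p l * t - beta) <= m%:R.
    have -> : m%:R = \sum_(l < m) (1 : R) by rewrite sumr_const card_ord.
    by apply: ler_sum => l _; have := f01 l; lra.
  have pk0 := ltW (hp k).
  have := ler_wpM2l pk0 summ; have := mulr_ge0 pk0 sum0.
  have := f01 k; have := ler_norm (C k).
  have := ler_norm (- C k); rewrite normrN ler_norml; lra.
have sigma_lim k : n%:R^-1 * (sigma n k)%:R @[n --> \oo] --> p k.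
  exact: average_of_linear (sigma_near k).
have sigma_oo k : sigma n k @[n --> \oo] --> \oo.
  apply/cvgnyPge => A; near=> n.
  have : `|(sigma n k)%:R - n%:R * p k| <= `|C k| + 1 + p k * m%:R.
    by near: n; exact: sigma_near.
  have : (A%:R + (`|C k| + 1 + p k * m%:R)) / p k <= n%:R.
    by near: n; exact: nbhs_infty_ger.
  rewrite ler_pdivrMr// ler_norml -(ler_nat R); lra.
(* A primitive of the fractional part for [k] as a function of the house size, with the jumps sorted
   by winning party. *)
pose Phi k n := \sum_j jump_sum p beta j k (sigma n j).
have Phi_lim k : n%:R^-1 * Phi k n @[n --> \oo] --> 2^-1 * (1 - p k).
  (* Party [j] wins with frequency [p j], and the mean along its wins is [1/2], or [0] if
     [j = k]. *)
  have -> : 2^-1 * (1 - p k) = \sum_j p j * (2^-1 * (j != k)%:R).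
    have -> : 1 - p k = \sum_(j | j != k) p j.
      by rewrite -hsum (bigD1 k)//= addrAC subrr add0r.
    rewrite [RHS](bigD1 k)//= eqxx !mulr0 add0r mulr_sumr.
    by apply: eq_bigr => j jk; rewrite jk mulr1 mulrC.
  under eq_fun do rewrite mulr_sumr.
  apply: cvg_sum_ord => j.
  have E n : n%:R^-1 * jump_sum p beta j k (sigma n j) =
      (n%:R^-1 * (sigma n j)%:R) *
      ((sigma n j)%:R^-1 * jump_sum p beta j k (sigma n j)).
    (* Without seats the factor [(sigma n j)%:R^-1] cannot be cancelled, but then the sum is
       empty. *)
    have [->|nz] := eqVneq (sigma n j) 0%N.
      by rewrite /jump_sum big_ord0 !mulr0.
    by rewrite -mulrA mulVKf// pnatr_eq0.
  under eq_fun do rewrite E.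
  have J := cvg_comp _ _ (sigma_oo j) (@jump_sum_mean _ _ p beta hp hind j k).
  exact: cvgM (sigma_lim j) J.
(* By [excess_at_jump] and [jump_sum_step], the excess at house size [n.+1] is eventually the
   increment of [H]. *)
pose H n := n%:R * C i - Phi i n + p i * \sum_k Phi k n.
apply: (@average_telescope _ _ H).
  have [n1 _ hn1] := hsigma; exists n1 => // n /= le_n.
  have [[t' [j' jump']] sn' _] := hn1 _ le_n.
  have [[t [j jump]] sn ->] := hn1 _ (leqW le_n).
  have Phi_step k : Phi k n.+1 - Phi k n = frac (p k * t - beta).
    by rewrite (jump_sum_step hp k jump jump') ?sn ?sn'.
  have := excess_at_jump hsum i jump; rewrite sn => ->.
  under [X in _ + _ * X]eq_bigr do rewrite -Phi_step.
  by rewrite -Phi_step sumrB /H -/(C i) -natr1; ring.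
have -> : (beta - 2^-1) * (m%:R * p i - 1) =
    C i - 2^-1 * (1 - p i) + p i * \sum_k (2^-1 * (1 - p k)).
  by rewrite -mulr_sumr sumrB hsum sumr_const card_ord /C; field.
have lim : (C i - n%:R^-1 * Phi i n + p i * \sum_k (n%:R^-1 * Phi k n))
    @[n --> \oo] --> C i - 2^-1 * (1 - p i) + p i * \sum_k (2^-1 * (1 - p k)).
  apply: cvgD; first by apply: cvgB => //; exact: cvg_cst.
  by apply: cvgM; [exact: cvg_cst|exact: cvg_sum_ord].
apply: cvg_trans lim; apply: near_eq_cvg.
exists 1%N => // n /= n1; rewrite -mulr_sumr /H; field.
by rewrite pnatr_eq0 -lt0n.
Unshelve. all: by end_near. Qed.
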